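(* Let $K$ be a field of characteristic $p>0$ and let $L/K$ be a purely inseparable finite field extension. Then: 1. $\mathcal{A}(\mathcal{D}(L/K),L)=\mathcal{A}(\mathcal{D}(L/K),L,sim)=\{\mathcal{D}(L/M)\mid M\in\mathcal{F}(L/K)\}$. 2. The map $$\mathcal{F}(L/K)\to\mathcal{A}(\mathcal{D}(L/K),L)=\mathcal{A}(\mathcal{D}(L/K),L,sim),\quad M\mapsto C_{\mathcal{D}(L/K)}(M)=\mathcal{D}(L/M)$$ is a bijection with inverse $A\mapsto C_{\mathcal{D}(L/K)}(A)$. 3. $\mathbb{L}(L/K)=\{\mathcal{G}(M)=\mathcal{D}(L/M)_+\mid M\in\mathcal{F}(L/K)\}$. 4. The map $$\mathcal{F}(L/K)\to\mathbb{L}(L/K),\quad M\mapsto\mathcal{G}(M)=\mathcal{D}(L/M)_+$$ is a bijection with inverse $\mathcal{G}\mapsto L^{\mathcal{G}}=C_L(\mathcal{G})$.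
   Context: For a finite field extension $L/K$: $\mathcal{D}(L/K)=\bigcup_{i\ge0}\mathcal{D}_i\subseteq\mathrm{End}_K(L)$ is the algebra of $K$-linear differential operators on $L$, where $\mathcal{D}_0=L$ (acting by multiplication) and $\mathcal{D}_i=\{\delta\in\mathrm{End}_K(L)\mid\delta l-l\delta\in\mathcal{D}_{i-1}\text{ for all }l\in L\}$. $\mathcal{D}(L/K)_+=\{\delta\in\mathcal{D}(L/K)\mid\delta(1)=0\}$, a left ideal of $\mathcal{D}(L/K)$ and a Lie algebra under the commutator. $\mathcal{F}(L/K)$ is the set of intermediate fields $K\subseteq M\subseteq L$; for such $M$, $\mathcal{D}(L/M)$ and $\mathcal{D}(L/M)_+$ are defined in the same way for $L/M$ (and lie in $\mathcal{D}(L/K)$). $\mathcal{A}(\mathcal{D}(L/K),L)$ (resp. $\mathcal{A}(\mathcal{D}(L/K),L,sim)$) is the set of all (resp. all simple) $K$-subalgebras of $\mathcal{D}(L/K)$ containing $L$. $C_{\mathcal{D}(L/K)}(S)$ is the centralizer of $S$ in $\mathcal{D}(L/K)$. For $S\subseteq\mathcal{D}(L/K)$: $C_L(S)=\{l\in L\mid ls=sl\text{ for all }s\in S\}$ and $L^S=\{l\in L\mid s(l)=0\text{ for all }s\in S\}$. A Lie subalgebra $\mathcal{G}$ of $\mathcal{D}(L/K)_+$ is called balanced if $C_L(\mathcal{G})=L^{\mathcal{G}}$; $\mathcal{L}(L/K)$ is the set of balanced Lie subalgebras. $\mathcal{G}\in\mathcal{L}(L/K)$ is called dominant if $\mathcal{G}'\subseteq\mathcal{G}$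 for all $\mathcal{G}'\in\mathcal{L}(L/K)$ with $L^{\mathcal{G}'}=L^{\mathcal{G}}$. $\mathbb{L}(L/K)$ is the set of dominant Lie algebras. For $M\in\mathcal{F}(L/K)$, $\mathcal{G}(M)$ denotes the union of all $\mathcal{G}\in\mathcal{L}(L/K)$ with $L^{\mathcal{G}}=C_L(\mathcal{G})=M$. *)

(* Defs.v *)
From mathcomp Require Import all_boot all_order all_algebra all_field.
From mathcomp Require Import boolp classical_sets functions.

Set Implicit Arguments.
Unset Strict Implicit.
Unset Printing Implicit Defensive.

Import GRing.Theory.
Local Open Scope classical_set_scope.
Local Open Scope ring_scope.

(* Subsets of L and of End_K(L) are Prop-valued sets, so that equality of      *)
(* subsets is extensional.  The product on 'End(L) is the composition \o, and  *)
(* l : L is identified with the multiplication amull l : 'End(L).  The type    *)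
(* {subfield L} is exactly the set F(L/K) of intermediate fields; K itself is  *)
(* 1%AS.                                                                       *)

Section DiffOps.
Variables (K : fieldType) (L : fieldExtType K).
Implicit Types (M : {subfield L}) (S A I G : set 'End(L)).

Definition lmuls : set 'End(L) := range (@amull K L).

Definition subf_lmuls M : set 'End(L) := [set amull m | m in [set x | x \in M]].

Definition lie_bracket (f g : 'End(L)) : 'End(L) := ((f \o g) - (g \o f))%VF.

Definition endo_over M : set 'End(L) :=
  [set f | forall m x, m \in M -> f (m * x) = m * f x].

Fixpoint diffop_ord M (i : nat) : set 'End(L) :=
  if i is j.+1 then
    [set f | endo_over M f /\
             forall l, diffop_ord M j (lie_bracket f (amull l))]
  else lmuls.

Definition diffop M : set 'End(L) := \bigcup_i diffop_ord M i.

Definition diffop_plus M : set 'End(L) := [set f | diffop M f /\ f 1 = 0].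

Definition cent_diffop S : set 'End(L) :=
  [set f | diffop 1%AS f /\ forall s, S s -> (f \o s = s \o f)%VF].

Definition comp_closed S := forall f g, S f -> S g -> S (f \o g)%VF.

(* The unit of A is automatic here, since amull 1 = \1%VF. *)
Definition subalgs_containing_L : set (set 'End(L)) :=
  [set A | [/\ A `<=` diffop 1%AS, submod_closed [in A], comp_closed A
             & lmuls `<=` A]].

Definition two_sided_ideal A I :=
  [/\ I `<=` A, submod_closed [in I]
    & forall a x, A a -> I x -> I (a \o x)%VF /\ I (x \o a)%VF].

Definition simple_alg A :=
  A <> [set 0] /\ forall I, two_sided_ideal A I -> I = [set 0] \/ I = A.

Definition simple_subalgs_containing_L : set (set 'End(L)) :=
  [set A | subalgs_containing_L A /\ simple_alg A].

Definition cent_L S : set L :=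
  [set l | forall s, S s -> (amull l \o s = s \o amull l)%VF].

Definition invariants S : set L := [set l | forall s, S s -> s l = 0].

Definition lie_subalg G :=
  [/\ G `<=` diffop_plus 1%AS, submod_closed [in G]
    & forall f g, G f -> G g -> G (lie_bracket f g)].

Definition balanced_lie : set (set 'End(L)) :=
  [set G | lie_subalg G /\ cent_L G = invariants G].

Definition dominant_lie : set (set 'End(L)) :=
  [set G | balanced_lie G /\
     forall G', balanced_lie G' -> invariants G' = invariants G -> G' `<=` G].

Definition lie_of M : set 'End(L) :=
  \bigcup_(G in [set G | [/\ balanced_lie G,
                             invariants G = [set x | x \in M]
                           & cent_L G = [set x | x \in M]]]) G.

End DiffOps.

Arguments subalgs_containing_L {K} L.
Arguments simple_subalgs_containing_L {K} L.
Arguments dominant_lie {K} L.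

(* Main.v *)
(* Pure inseparability makes every commutator [., l] nilpotent on End_M(L), as
   ad(l)^(p^e) = ad(l^(p^e)), and these operators commute; hence End_M(L) has no
   element outside D(L/M), that is D(L/M) = End_M(L).  The rest is the
   Jacobson-Bourbaki correspondence.  If a subalgebra A contains L, take f_i in
   A and x_i in L with f_i(x_j) = delta_ij and a = sum_i a(x_i) f_i for all a in
   A.  Applied to a l f_i, this gives a(l f_i(y)) = a(l) f_i(y), so f_i takes
   values in M = C_L(A); applied to 1, it gives y = sum_i x_i f_i(y), whence
   g = sum_i g(x_i) f_i for every M-linear g, and A = End_M(L).  Conversely M is
   recovered from End_M(L) by means of an M-linear retraction of L onto M. *)
From HB Require Import structures.
Require Import Defs.
From mathcomp Require Import all_boot all_order all_algebra all_field.
From mathcomp Require Import boolp classical_sets functions.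

Set Implicit Arguments.
Unset Strict Implicit.
Unset Printing Implicit Defensive.

Import GRing.Theory.
Local Open Scope classical_set_scope.
Local Open Scope ring_scope.

(** * Linear algebra on sets of vectors; Frobenius for commuting elements *)

Lemma submod_closed_setP (R : pzRingType) (V : lmodType R) (A : set V) :
  submod_closed [in A] <->
  A 0 /\ forall k f g, A f -> A g -> A (k *: f + g).
Proof.
split=> -[A0 AD]; split.
- by move: A0; rewrite inE.
- by move=> k f g Af Ag; apply/set_mem/AD; apply/mem_set.
- by rewrite inE.
- by move=> k f g /set_mem Af /set_mem Ag; apply/mem_set/AD.
Qed.

Lemma submod_set_sum (R : pzRingType) (V : lmodType R) (A : set V)
    (I : Type) (s : seq I) (P : pred I) (F : I -> V) :
  submod_closed [in A] -> (forall i, P i -> A (F i)) ->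
  A (\sum_(i <- s | P i) F i).
Proof.
case/submod_closed_setP=> A0 AD AF; apply: (big_ind A) => // f g Af Ag.
by rewrite -[f]scale1r; apply: AD.
Qed.

(** A subspace inside [S] of maximal dimension exhausts [S]: adjoining a vector of [S] stays inside
    [S], so it cannot raise the dimension. *)
Lemma vspace_of_set (K : fieldType) (vT : vectType K) (S : set vT) :
  submod_closed [in S] ->
  exists U : {vspace vT}, [set x | x \in U] = S.
Proof.
case/submod_closed_setP=> S0 SD.
pose P n :=
  `[< exists2 U : {vspace vT}, [set x | x \in U] `<=` S & \dim U = n >].
have P0 : exists n, P n.
  exists 0%N; apply/asboolP; exists 0%VS; last exact: dimv0.
  by move=> x /=; rewrite memv0 => /eqP->.
have Pmax n : P n -> (n <= \dim {:vT})%N.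
  by case/asboolP=> U _ <-; apply/dimvS/subvf.
case: (ex_maxnP P0 Pmax) => n /asboolP[U US <-] Umax; exists U.
apply/seteqP; split=> // x Sx /=.
have /Umax : P (\dim (<[x]> + U)).
  apply/asboolP; exists (<[x]> + U)%VS => // z /= /memv_addP[_ /vlineP[k ->]].
  by case=> u /US Su ->; apply: SD.
move=> dimU; have : (<[x]> + U)%VS == U by rewrite eq_sym eqEdim addvSr.
by move/eqP <-; apply: (subvP (addvSl _ _)); rewrite memv_line.
Qed.

(** The Frobenius identity for a commuting pair, iterated; [R] may be noncommutative, as rings of
    endomorphisms are. *)
Lemma exprBn_pchar_comm (R : nzRingType) (p e : nat) (x y : R) :
  p \in [pchar R] -> GRing.comm x y ->
  (x - y) ^+ (p ^ e) = x ^+ (p ^ e) - y ^+ (p ^ e).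
Proof.
move=> pR cxy; elim: e => [|e IHe]; first by rewrite !expr1.
rewrite expnSr !exprM IHe -!(pFrobenius_autE pR) pFrobenius_autB_comm //.
exact/commrX/commr_sym/commrX/commr_sym.
Qed.

Lemma linear_linfunE (R : nzRingType) (aT rT : vectType R) (f : aT -> rT) :
  linear f -> linfun f =1 f.
Proof.
move=> flin; pose f' : {linear aT -> rT} :=
  HB.pack f (GRing.isLinear.Build R aT rT _ f flin).
exact: (lfunE f').
Qed.

(** * Brackets with multiplications and the order filtration *)

Section Bracket.
Variables (K : fieldType) (L : fieldExtType K).
Implicit Types (M : {subfield L}) (A S : set 'End(L)) (f g : 'End(L)).

Lemma amullE (u v : L) : amull u v = u * v.
Proof. by rewrite lfunE. Qed.

Lemma amull_comp (u v : L) : amull (u * v) = (amull u \o amull v)%VF.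
Proof. by apply/lfunP=> w; rewrite comp_lfunE !amullE mulrA. Qed.

Lemma lie_bracket_amullE f (l x : L) :
  lie_bracket f (amull l) x = f (l * x) - l * f x.
Proof. by rewrite add_lfunE opp_lfunE !comp_lfunE !amullE. Qed.

Lemma lie_bracket_is_linear_l (l : L) :
  linear (fun f => lie_bracket f (amull l)).
Proof.
move=> k f g; apply/lfunP=> x.
rewrite [RHS]add_lfunE [in RHS]scale_lfunE !lie_bracket_amullE.
rewrite !add_lfunE !scale_lfunE.
by rewrite mulrDr scalerBr -scalerAr opprD addrACA.
Qed.

Lemma comp_lfun_is_linear_l g : linear (fun f : 'End(L) => (f \o g)%VF).
Proof. by move=> k f h; rewrite comp_lfunDl comp_lfunZl. Qed.

Lemma comp_lfun_is_linear_r g : linear (fun f : 'End(L) => (g \o f)%VF).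
Proof. by move=> k f h; rewrite comp_lfunDr comp_lfunZr. Qed.

(* The commuting operators of right and left multiplication by [l] satisfy
   (r - l)^(p^e) = r^(p^e) - l^(p^e) in characteristic p. *)
Lemma iter_bracket p e f (l : L) : p \in [pchar K] ->
  iter (p ^ e) (fun h => lie_bracket h (amull l)) f =
  lie_bracket f (amull (l ^+ (p ^ e))).
Proof.
move=> pK; have End_proper : (0 < \dim {: 'End(L)})%N.
  rewrite lt0n dimv_eq0; apply/eqP=> End0.
  have : \1%VF \in {: 'End(L)}%VS := memvf _.
  rewrite End0 memv0 => /eqP/lfunP/(_ 1); rewrite !lfunE /= => /eqP.
  by rewrite oner_eq0.
rewrite dimvf in End_proper.
(* [R] is the ring of endomorphisms of ['End(L)]; in it [X b] and [Y b] are right and left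
   composition with [amull b]. *)
pose R : nzRingType := lfun_comp_nzRingType End_proper.
pose X b : R := linfun (fun g : 'End(L) => (g \o amull b)%VF).
pose Y b : R := linfun (fun g : 'End(L) => (amull b \o g)%VF).
have XE b g : (X b : 'End('End(L))) g = (g \o amull b)%VF.
  exact/linear_linfunE/comp_lfun_is_linear_l.
have YE b g : (Y b : 'End('End(L))) g = (amull b \o g)%VF.
  exact/linear_linfunE/comp_lfun_is_linear_r.
have mulRE (u v : R) g : (u * v : 'End('End(L))) g =
  (u : 'End('End(L))) ((v : 'End('End(L))) g) by exact: comp_lfunE.
have pR : p \in [pchar R].
  rewrite inE (pcharf_prime pK) /=; apply/eqP/lfunP=> g.
  have natRE n : (n%:R : R) = n%:R *: (\1%VF : 'End('End(L))).
    elim: n => [|n IHn]; first by rewrite scale0r.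
    by rewrite !mulrSr IHn scalerDl scale1r.
  by rewrite natRE (pcharf0 pK) scale0r.
have XY : GRing.comm (X l) (Y l).
  by apply/lfunP=> g; rewrite !mulRE !XE !YE comp_lfunA.
have XX n : X l ^+ n = X (l ^+ n).
  apply/lfunP=> g; elim: n g => [|n IHn] g.
    by rewrite XE amull1 comp_lfun1r expr0 lfunE.
  by rewrite exprSr mulRE IHn !XE exprS amull_comp comp_lfunA.
have YX n : Y l ^+ n = Y (l ^+ n).
  apply/lfunP=> g; elim: n g => [|n IHn] g.
    by rewrite YE amull1 comp_lfun1l expr0 lfunE.
  by rewrite exprSr mulRE IHn !YE exprSr amull_comp comp_lfunA.
have subRE (u v : R) g : (u - v : 'End('End(L))) g =
    (u : 'End('End(L))) g - (v : 'End('End(L))) g.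
  by rewrite add_lfunE opp_lfunE.
have itE n : iter n (fun h => lie_bracket h (amull l)) f =
  ((X l - Y l) ^+ n : 'End('End(L))) f.
  elim: n => [|n IHn]; first by rewrite expr0 lfunE.
  by rewrite iterS IHn exprS mulRE subRE XE YE.
by rewrite itE exprBn_pchar_comm // XX YX subRE XE YE.
Qed.

Variable M : {subfield L}.

Lemma diffop_ord_endo_over i : diffop_ord M i `<=` endo_over M.
Proof.
move=> f; case: i => [/= [l _ <-] m x _|i /= []] //.
by rewrite !amullE mulrCA.
Qed.

Lemma diffop_ordS i : diffop_ord M i `<=` diffop_ord M i.+1.
Proof.
elim: i => [|i IHi] f fi; (split; first exact: diffop_ord_endo_over fi) => l.
  case: fi => u _ <-; exists 0 => //; rewrite linear0; apply/esym/lfunP=> x.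
  by rewrite lie_bracket_amullE !amullE mulrCA subrr lfunE.
by have [_ /(_ l)/IHi] := fi.
Qed.

Lemma diffop_ord_mono i j : (i <= j)%N -> diffop_ord M i `<=` diffop_ord M j.
Proof.
by move/subnK<-; elim: (j - i)%N => // n IHn f /IHn; apply: diffop_ordS.
Qed.

Lemma endo_over_submod : submod_closed [in endo_over M].
Proof.
apply/submod_closed_setP; split=> [m x _|k f g fM gM m x Mm].
  by rewrite !lfunE /= mulr0.
by rewrite !add_lfunE !scale_lfunE fM // gM // scalerAr mulrDr.
Qed.

Lemma diffop_ord_submod i : submod_closed [in diffop_ord M i].
Proof.
have /submod_closed_setP[E0 ED] := endo_over_submod.
elim: i => [|i /submod_closed_setP[D0 DD]]; apply/submod_closed_setP.
  split=> [|k _ _ [u _ <-] [v _ <-]]; first by exists 0; rewrite ?linear0.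
  by exists (k *: u + v); rewrite ?linearP.
split=> [|k f g [fM fD] [gM gD]].
  split=> // l; rewrite (_ : lie_bracket 0 _ = 0) //; apply/lfunP=> x.
  by rewrite lie_bracket_amullE !lfunE /= mulr0 subrr.
split=> [|l]; first exact: ED.
have /= -> := lie_bracket_is_linear_l l k f g.
by apply: DD; [apply: fD | apply: gD].
Qed.

Lemma lie_bracket_is_linear_r f : linear (fun l : L => lie_bracket f (amull l)).
Proof.
move=> k u v; apply/lfunP=> x.
rewrite [RHS]add_lfunE [in RHS]scale_lfunE !lie_bracket_amullE.
by rewrite !mulrDl -!scalerAl linearP scalerBr opprD addrACA.
Qed.

Lemma lie_bracket_endo_over f l :
  endo_over M f -> endo_over M (lie_bracket f (amull l)).
Proof.
move=> fM m x Mm; rewrite !lie_bracket_amullE.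
by rewrite mulrCA !(fM m) // mulrBr [l * (m * _)]mulrCA.
Qed.

Lemma lie_bracket_diffop f l : diffop M f -> diffop M (lie_bracket f (amull l)).
Proof.
by case=> i _ fi; have [_ Df] := diffop_ordS fi; exists i => //; apply: Df.
Qed.

(** The Jacobi identity: [amull l] and [amull m] commute, hence so do the brackets with them. *)
Lemma lie_bracket_amullC f (l m : L) :
  lie_bracket (lie_bracket f (amull l)) (amull m) =
  lie_bracket (lie_bracket f (amull m)) (amull l).
Proof.
apply/lfunP=> x; rewrite !lie_bracket_amullE !mulrBr !opprB.
rewrite (mulrCA l m x) (mulrCA l m (f x)) addrACA [RHS]addrACA; congr (_ + _).
exact: addrC.
Qed.

Lemma diffop_finite_brackets f (s : seq L) :
  (forall l, l \in s -> diffop M (lie_bracket f (amull l))) ->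
  exists i, forall l, l \in s -> diffop_ord M i (lie_bracket f (amull l)).
Proof.
elim: s => [|l s IHs] Ds; first by exists 0%N.
have [|i Di] := IHs; first by move=> b sb; apply: Ds; rewrite inE sb orbT.
have [j _ Dj] := Ds l (mem_head _ _); exists (maxn i j) => b.
rewrite inE => /predU1P[->|/Di]; last exact/diffop_ord_mono/leq_maxl.
by apply: diffop_ord_mono Dj; apply: leq_maxr.
Qed.

(** [diffop_ord] asks for one order bounding the brackets with all [l]. Brackets are linear in [l],
    so a basis suffices, and finitely many orders have a maximum. *)
Lemma diffop_brackets f : endo_over M f ->
  (forall l, l \in vbasis {:L} -> diffop M (lie_bracket f (amull l))) ->
  diffop M f.
Proof.
move=> fM /diffop_finite_brackets[i Di]; exists i.+1 => //; split=> // l.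
rewrite (coord_vbasis (memvf l)).
set b := vbasis {:L} in Di *.
have -> : lie_bracket f (amull (\sum_j coord b j l *: b`_j)) =
    \sum_j coord b j l *: lie_bracket f (amull b`_j).
  rewrite -(linear_linfunE (lie_bracket_is_linear_r f)) linear_sum.
  apply: eq_bigr => j _; rewrite linearZ /=.
  by rewrite (linear_linfunE (lie_bracket_is_linear_r f)).
apply: submod_set_sum (diffop_ord_submod i) _ => j _.
have /submod_closed_setP[D0 DD] := diffop_ord_submod i.
rewrite -[X in diffop_ord _ _ X]addr0; apply: DD => //.
by apply/Di/mem_nth; rewrite size_tuple.
Qed.

(* The brackets with the elements of [s] act on [endo_over M] / [diffop M] as
   commuting nilpotent operators, so they have a common kernel. *)
Lemma nondiffop_brackets p f (s : seq L) : p \in [pchar K] ->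
  (forall l, exists e, l ^+ (p ^ e) \in M) -> endo_over M f -> ~ diffop M f ->
  exists g, [/\ endo_over M g, ~ diffop M g &
    forall l, l \in s -> diffop M (lie_bracket g (amull l))].
Proof.
move=> pK pM fM nDf; elim: s => [|l s [g [gM nDg gs]]]; first by exists f.
pose h n := iter n (fun f => lie_bracket f (amull l)) g.
have [e le] := pM l.
have hM n : endo_over M (h n).
  by elim: n => //= n IHn; apply: lie_bracket_endo_over.
have hs n b : b \in s -> diffop M (lie_bracket (h n) (amull b)).
  move=> sb; elim: n => [|n IHn]; first exact: gs.
  by rewrite /= lie_bracket_amullC; apply: lie_bracket_diffop.
(* [g] commutes with [l ^+ (p ^ e)], which lies in [M], so the iterated bracket vanishes after
   [p ^ e] steps. *)
have Dh : exists n, `[< diffop M (h n) >].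
  exists (p ^ e)%N; apply/asboolP; rewrite /h (iter_bracket _ _ _ pK).
  rewrite (_ : lie_bracket _ _ = 0).
    by exists 0%N => //; exists 0; rewrite ?linear0.
  by apply/lfunP=> x; rewrite lie_bracket_amullE gM // subrr lfunE.
(* The least such number is positive because [g] is outside [diffop M]; one step earlier the
   operator is still outside, but its bracket with [l] is inside. *)
case: (ex_minnP Dh) => -[/asboolP // | n /asboolP Dn minn].
exists (h n); split=> // [/asboolP/minn|b]; first by rewrite ltnn.
by rewrite inE => /predU1P[-> //|]; apply: hs.
Qed.

(** An [M]-linear operator outside [diffop M] would yield another one whose brackets with a whole
    basis are inside, which puts it inside. *)
Lemma diffop_endo_over p : p \in [pchar K] ->
  (forall l, exists e, l ^+ (p ^ e) \in M) -> diffop M = endo_over M.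
Proof.
move=> pK pM; apply/seteqP; split=> [f [i _ /diffop_ord_endo_over] // | f fM].
apply: contrapT => /(nondiffop_brackets (vbasis {:L}) pK pM fM).
by case=> g [gM nDg /(diffop_brackets gM)].
Qed.

End Bracket.

(** * Centralizers in L and retractions onto intermediate fields *)

Section FieldExt.
Variables (K : fieldType) (L : fieldExtType K).
Implicit Types (M : {subfield L}) (A S : set 'End(L)) (f g : 'End(L)).

Lemma cent_LE S (l : L) :
  cent_L S l <-> forall s x, S s -> s (l * x) = l * s x.
Proof.
split=> [cl s x Ss | cl s Ss].
  by have /lfunP/(_ x) := cl s Ss; rewrite !comp_lfunE !amullE.
by apply/lfunP=> x; rewrite !comp_lfunE !amullE cl.
Qed.

(** A [{subfield L}] is a unital subalgebra, inverses being automatic in finite dimension. *)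
Lemma cent_L_subfield S : exists M, [set x | x \in M] = cent_L S.
Proof.
have [|U US] := @vspace_of_set K L (cent_L S).
  apply/submod_closed_setP; split=> [|k u v /cent_LE cu /cent_LE cv].
    by apply/cent_LE=> s x Ss; rewrite !mul0r linear0.
  apply/cent_LE=> s x Ss.
  by rewrite !mulrDl -!scalerAl linearP /= (cu s) // (cv s).
have memU u : u \in U <-> cent_L S u by rewrite -US.
have Ualg : is_aspace U.
  rewrite /is_aspace has_algid1; last first.
    by apply/memU/cent_LE=> s x Ss; rewrite !mul1r.
  apply/prodvP=> u v /memU/cent_LE cu /memU/cent_LE cv.
  by apply/memU/cent_LE=> s x Ss; rewrite -!mulrA cu ?cv.
by exists (ASpace Ualg).
Qed.

(** View [L] as a vector space over [M] and project onto the subspace [M]. *)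
Lemma endo_over_retraction M :
  exists f, [/\ endo_over M f, f 1 = 1 & forall x, f x \in M].
Proof.
pose E := vspaceOver M M; have memE x : (x \in E) = (x \in M).
  exact: mem_aspaceOver.
pose g (x : L) : L := projv E (x : fieldOver M).
have gM m x : m \in M -> g (m * x) = m * g x.
  move=> Mm; rewrite /g -[m in LHS](vsprojK Mm) -[m in RHS](vsprojK Mm).
  by rewrite -fieldOver_scaleE -[RHS]fieldOver_scaleE linearZ.
have gD x y : g (x + y) = g x + g y.
  exact: (linearD (projv E) (x : fieldOver M) (y : fieldOver M)).
(* Scalars of [K] lie in [M], so [M]-linearity gives [K]-linearity. *)
have glin : linear g.
  move=> k x y; rewrite gD -mulr_algl gM ?mulr_algl //.
  by rewrite rpredZ ?mem1v.
exists (linfun g); split=> [m x Mm||x]; rewrite !(linear_linfunE glin).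
- exact: gM.
- apply: (@projv_id _ (fieldOver M) E (1 : L)).
  by rewrite memE; apply: (mem1v M).
- by rewrite -memE memv_proj.
Qed.

(** * Dual families and the subalgebras containing L *)

(* Only the values [f i] and [x i] with [i < r] matter. *)
Definition dual_family A r (f : nat -> 'End(L)) (x : nat -> L) :=
  (forall i, (i < r)%N -> A (f i)) /\
  (forall i j, (i < r)%N -> (j < r)%N -> f i (x j) = (i == j)%:R).

(** Applying [f i] to a linear relation between the [x j] isolates its [i]-th coefficient, so the
    [x j] are free. *)
Lemma dual_family_bound A r (f : nat -> 'End(L)) x :
  dual_family A r f x -> (r <= \dim {:L})%N.
Proof.
case=> _ fx; pose X := [tuple x i | i < r].
have /eqP : free X.
  apply/freeP=> k kX i; have /(congr1 (f i)) := kX.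
  rewrite linear0 linear_sum (bigD1 i) //= big1 => [|j ij].
    rewrite addr0 linearZ /= (nth_map i) ?size_enum_ord // nth_ord_enum fx //.
    by rewrite eqxx => /eqP; rewrite scaler_eq0 oner_eq0 orbF => /eqP.
  rewrite linearZ /= (nth_map i) ?size_enum_ord // nth_ord_enum fx //.
  by rewrite -val_eqE eq_sym /= in ij; rewrite (negPf ij) scaler0.
by rewrite size_tuple => <-; apply/dimvS/subvf.
Qed.

Section Subalgebra.
Variable A : set 'End(L).
Hypotheses (Asub : submod_closed [in A]) (Acomp : comp_closed A).
Hypothesis AL : @lmuls K L `<=` A.

Let Amul u f : A f -> A (amull u \o f)%VF.
Proof. by move=> Af; apply: Acomp => //; apply: AL; exists u. Qed.

Let AB f g : A f -> A g -> A (f - g).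
Proof.
move=> Af Ag; have /submod_closed_setP[_ AD] := Asub.
by rewrite addrC -scaleN1r; apply: AD.
Qed.

(** A Gram-Schmidt step: the defect [b] of the expansion of [a] kills every [x i] but not [y];
    rescaled to [c] with [c y = 1], it becomes the dual of [y]. *)
Lemma dual_family_extend r (f : nat -> 'End(L)) x a y :
  dual_family A r f x -> A a -> a y != \sum_(i < r) a (x i) * f i y ->
  exists (f' : nat -> 'End(L)) x', dual_family A r.+1 f' x'.
Proof.
case=> Af fx Aa; pose b := a - \sum_(i < r) (amull (a (x i)) \o f i)%VF.
have bE z : b z = a z - \sum_(i < r) a (x i) * f i z.
  rewrite !lfunE /= !lfunE /= sum_lfunE; congr (_ - _).
  by apply: eq_bigr => i _; rewrite comp_lfunE amullE.
rewrite -subr_eq0 -bE => by0.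
have bx j : (j < r)%N -> b (x j) = 0.
  move=> ltjr; rewrite bE (bigD1 (Ordinal ltjr)) //= fx // eqxx mulr1.
  rewrite big1 ?addr0 ?subrr // => i; rewrite -val_eqE /= => ij.
  by rewrite fx // (negPf ij) mulr0.
pose c := (amull ((b y)^-1)%R \o b)%VF.
have Ac : A c.
  by apply/Amul/AB => //; apply: submod_set_sum => // i _; apply/Amul/Af.
have cy : c y = 1 by rewrite comp_lfunE amullE mulVf.
have cx j : (j < r)%N -> c (x j) = 0.
  by move=> ltjr; rewrite comp_lfunE bx // linear0.
(* Subtracting [f i y] times [c] makes [f i] vanish at [y] and keeps its values at the [x j]. *)
exists (fun i => if (i < r)%N then f i - (amull (f i y) \o c)%VF else c).
exists (fun i => if (i < r)%N then x i else y); split=> [i|i j].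
  by case: (ltnP i r) => // ltir _; apply: AB; [apply: Af | apply: Amul].
rewrite !ltnS; case: (ltnP i r) => [ltir _|geir leir];
  case: (ltnP j r) => [ltjr _|gejr lejr].
- by rewrite add_lfunE opp_lfunE comp_lfunE cx // amullE mulr0 subr0 fx.
- rewrite add_lfunE opp_lfunE comp_lfunE cy amullE mulr1 subrr.
  by rewrite ltn_eqF // (leq_trans ltir).
- by rewrite cx // gtn_eqF // (leq_trans ltjr).
- by rewrite cy (@anti_leq i r) ?leir // (@anti_leq j r) ?lejr // eqxx.
Qed.

(** Were no family complete, each could be extended, up to a size above [\dim {:L}]. *)
Lemma dual_family_complete : exists r (f : nat -> 'End(L)) x,
  dual_family A r f x /\
  forall a y, A a -> a y = \sum_(i < r) a (x i) * f i y.
Proof.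
apply: contrapT => nocomplete.
suff H r : exists (f : nat -> 'End(L)) x, dual_family A r f x.
  by have [f [x /dual_family_bound]] := H (\dim {:L}).+1; rewrite ltnn.
elim: r => [|r [f [x dfx]]]; first by exists (fun=> 0), (fun=> 0); split.
apply: contrapT => noext; apply: nocomplete; exists r, f, x; split=> // a y Aa.
by apply: contra_notP noext => /eqP; apply: dual_family_extend.
Qed.

(** The [f i] are coordinates of [L] relative to the [x i], with values in the field [cent_L A];
    they serve both to describe [A] and to prove it simple. *)
Lemma subalg_frame : exists r (f : 'I_r -> 'End(L)) (x : 'I_r -> L),
  [/\ forall i, A (f i), forall i y, cent_L A (f i y)
    & forall y, y = \sum_i x i * f i y].
Proof.
have [r [f [x [[Af fx] complete]]]] := dual_family_complete.
exists r, (fun i => f i), (fun i => x i).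
(* In the expansion of [a \o f i] only the term of [x i] survives, with coefficient [a 1]. *)
have afi a (i : 'I_r) y : A a -> a (f i y) = a 1 * f i y.
  move=> Aa; have := complete (a \o f i)%VF y.
  rewrite comp_lfunE => ->; last exact/Acomp/Af.
  rewrite (bigD1 i) //= big1 => [|j]; rewrite comp_lfunE.
    by rewrite fx // eqxx addr0.
  rewrite -val_eqE eq_sym /= => ij.
  by rewrite fx // (negPf ij) linear0 mul0r.
split=> [i|i y|y]; first exact: Af.
  (* With [a \o amull l] in place of [a], this reads [a (l * f i y) = a l * f i y]. *)
  apply/cent_LE=> a l Aa; have := afi (a \o amull l)%VF i y.
  rewrite !comp_lfunE !amullE mulr1 mulrC => ->; first by rewrite mulrC.
  by apply: Acomp => //; apply: AL; exists l.
have /(complete (amull 1) y) : A (amull 1) by apply: AL; exists 1.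
by rewrite amullE mul1r => {1}->; apply: eq_bigr => i _; rewrite amullE mul1r.
Qed.

(** For [M]-linear [g] the frame gives [g y = \sum_i g (x i) * f i y], a combination of the [f i]
    with coefficients in [L]. *)
Lemma subalg_endo_over M : [set x | x \in M] = cent_L A -> A = endo_over M.
Proof.
move=> defM; have memM m : m \in M <-> cent_L A m by rewrite -defM.
apply/seteqP; split=> [a Aa m x /memM/cent_LE cm|g gM]; first exact: cm.
have [r [f [x [Af cf xf]]]] := subalg_frame.
suff -> : g = \sum_i (amull (g (x i)) \o f i)%VF.
  by apply: submod_set_sum => // i _; apply/Amul/Af.
apply/lfunP=> y; rewrite [in LHS](xf y) linear_sum sum_lfunE /=.
apply: eq_bigr => i _; rewrite comp_lfunE amullE [x i * _]mulrC gM.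
  exact: mulrC.
exact/memM.
Qed.

(** A nonzero ideal contains some [h] with [h 1 = 1]. Hence it contains every [f i], then the
    identity by the frame, then all of [A]. *)
Lemma subalg_simple : simple_alg A.
Proof.
split=> [A0|I [IA Isub Iid]].
  have : A (amull 1) by apply: AL; exists 1.
  rewrite A0 => /lfunP/(_ 1); rewrite amullE lfunE /= mulr1 => /eqP.
  by rewrite oner_eq0.
have [[g Ig /eqP g0]|I0] := pselect (exists2 g, I g & g <> 0); last first.
  left; apply/seteqP; split=> [g Ig|_ ->].
    by apply: contrapT => g0; apply: I0; exists g.
  by have /submod_closed_setP[] := Isub.
right; apply/seteqP; split=> // a Aa.
have [y gy] : exists y, g y != 0.
  apply: contrapT => gy; case/negP: g0; apply/eqP/lfunP=> y; rewrite lfunE /=.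
  by apply: contrapT => /eqP gy0; apply: gy; exists y.
have Al l : A (amull l) by apply: AL; exists l.
(* Multiplication by [y] carries the nonzero value [g y] to the point [1], where dividing by it
   normalises. *)
pose h := (amull ((g y)^-1)%R \o (g \o amull y))%VF.
have Ih : I h by apply: (Iid _ _ (Al _) _).1; apply: (Iid _ _ (Al _) Ig).2.
have h1 : h 1 = 1 by rewrite !comp_lfunE !amullE mulr1 mulVf.
have [r [f [x [Af cf xf]]]] := subalg_frame.
(* [f i] takes values in [cent_L A], and [h \in A] fixes [cent_L A] *)
have If i : I (f i).
  suff -> : f i = (h \o f i)%VF by apply: (Iid _ _ (Af i) Ih).2.
  apply/lfunP=> z; rewrite comp_lfunE -[f i z in RHS]mulr1.
  have /cent_LE-> := cf i z; first by rewrite h1 mulr1.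
  exact: IA.
suff -> : a = (a \o \sum_i (amull (x i) \o f i))%VF.
  apply: (Iid _ _ Aa _).1; apply: submod_set_sum => // i _.
  exact: (Iid _ _ (Al _) (If i)).1.
apply/lfunP=> z; rewrite comp_lfunE sum_lfunE [in LHS](xf z); congr (a _).
by apply: eq_bigr => i _; rewrite comp_lfunE amullE.
Qed.

End Subalgebra.
End FieldExt.

(** * The correspondences for subalgebras and for Lie algebras *)

Section Correspondence.
Variables (K : fieldType) (L : fieldExtType K).
Implicit Types (M : {subfield L}) (A S G : set 'End(L)) (f g : 'End(L)).

Lemma endo_over1 f : endo_over 1%AS f.
Proof.
by move=> _ x /vlineP[k ->]; rewrite !mulr_algl linearZ.
Qed.

Lemma endo_over_comp M : comp_closed (endo_over M).
Proof. by move=> f g fM gM m x Mm; rewrite !comp_lfunE gM // fM. Qed.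

Lemma lmuls_endo_over M : @lmuls K L `<=` endo_over M.
Proof. by move=> _ [l _ <-] m x _; rewrite !amullE mulrCA. Qed.

(** If [l] commutes with a retraction [f] onto [M], then [l = l * f 1 = f l] lies in [M]. *)
Lemma cent_L_endo_over M : cent_L (endo_over M) = [set x | x \in M].
Proof.
apply/seteqP; split=> [l /cent_LE cl|m Mm]; last first.
  by apply/cent_LE=> f x fM; apply: fM.
have [f [fM f1 Mf]] := endo_over_retraction M.
by rewrite /= -[l]mulr1 -[X in _ * X]f1 -cl.
Qed.

(** Pure inseparability enters the correspondence through this equality alone. *)
Hypothesis diffopE : forall M, diffop M = endo_over M.

Lemma diffop_subalg M : subalgs_containing_L L (diffop M).
Proof.
rewrite diffopE; split.
- by rewrite diffopE => f _; apply: endo_over1.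
- exact: endo_over_submod.
- exact: endo_over_comp.
- exact: lmuls_endo_over.
Qed.

Lemma cent_diffop_subf_lmuls M : cent_diffop (subf_lmuls M) = diffop M.
Proof.
rewrite diffopE; apply/seteqP; split=> [f [_ cf] m x Mm|f fM].
  have /cf/lfunP/(_ x) : subf_lmuls M (amull m) by exists m.
  by rewrite !comp_lfunE !amullE.
split; first by rewrite diffopE; apply: endo_over1.
move=> _ [m Mm <-]; apply/lfunP=> x.
by rewrite !comp_lfunE !amullE fM.
Qed.

(** Commuting with all multiplications forces [f] to be [amull (f 1)]; commuting with [endo_over M]
    then forces [f 1] into [M]. *)
Lemma cent_diffop_diffop M : cent_diffop (diffop M) = subf_lmuls M.
Proof.
rewrite diffopE; apply/seteqP; split=> [f [_ cf]|_ [m Mm <-]]; last first.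
  split; first by rewrite diffopE; apply: endo_over1.
  move=> f fM; apply/lfunP=> x.
  by rewrite !comp_lfunE !amullE fM.
have fE x : f x = f 1 * x.
  have /cf/lfunP/(_ 1) : endo_over M (amull x).
    by apply: lmuls_endo_over; exists x.
  by rewrite !comp_lfunE !amullE mulr1 mulrC.
have fA : amull (f 1) = f by apply/lfunP=> x; rewrite amullE -fE.
exists (f 1) => //; rewrite -cent_L_endo_over => g gM; rewrite fA.
exact: cf.
Qed.

Lemma subalg_diffop A : subalgs_containing_L L A -> exists M, A = diffop M.
Proof.
case=> _ Asub Acomp AL; have [M defM] := cent_L_subfield A.
by exists M; rewrite diffopE; apply: subalg_endo_over.
Qed.

(** [M] lies in the centralizer, which lies in the invariants since the operators kill [1]. For the
    way back, take [\1%VF - f] with [f] a retraction onto [M]: an invariant [l] equals [f l]. *)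
Lemma invariants_diffop_plus M :
  invariants (diffop_plus M) = [set x | x \in M] /\
  cent_L (diffop_plus M) = [set x | x \in M].
Proof.
rewrite /diffop_plus diffopE; set S := [set f | _].
have MC : [set x | x \in M] `<=` cent_L S.
  by move=> m Mm; apply/cent_LE=> f x [fM _]; apply: fM.
have CI : cent_L S `<=` invariants S.
  move=> l /cent_LE cl f Sf; have [_ f1] := Sf.
  by rewrite -[l]mulr1 cl // f1 mulr0.
suff IM : invariants S `<=` [set x | x \in M].
  by split; apply/seteqP; split=> // l; [move/MC/CI | move/CI/IM].
have [f [fM f1 Mf]] := endo_over_retraction M.
move=> l /(_ (\1%VF - f)); rewrite add_lfunE opp_lfunE id_lfunE => fl.
have /fl/eqP : S (\1%VF - f).
  split=> [m x Mm|]; rewrite !add_lfunE !opp_lfunE !id_lfunE.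
    by rewrite fM // mulrBr.
  by rewrite f1 subrr.
by rewrite subr_eq0 => /eqP->; apply: Mf.
Qed.

Lemma balanced_diffop_plus M : balanced_lie (diffop_plus M).
Proof.
split; last by have [-> ->] := invariants_diffop_plus M.
rewrite /diffop_plus !diffopE.
split=> [f [_ f1]||f g [fM f1] [gM g1]].
- by split=> //; rewrite diffopE; apply: endo_over1.
- have /submod_closed_setP[E0 ED] := endo_over_submod M.
  apply/submod_closed_setP; split=> [|k f g [fM f1] [gM g1]].
    by split=> //; rewrite lfunE.
  split; first exact: ED.
  by rewrite add_lfunE scale_lfunE f1 g1 scaler0 addr0.
- split=> [m x Mm|]; rewrite add_lfunE opp_lfunE !comp_lfunE.
    by rewrite add_lfunE opp_lfunE !comp_lfunE !(fM m, gM m) // mulrBr.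
  by rewrite f1 g1 !linear0 addr0.
Qed.

(** Balance turns the invariants into centralizing elements, so the operators of [G] are
    [M]-linear. *)
Lemma balanced_sub_diffop_plus M G : balanced_lie G ->
  invariants G = [set x | x \in M] -> G `<=` diffop_plus M.
Proof.
case=> -[Gsub _ _] balG invG f Gf; have [_ f1] := Gsub f Gf.
split=> //; rewrite diffopE => m x Mm.
by have /cent_LE-> : cent_L G m by rewrite balG invG.
Qed.

Lemma lie_ofE M : lie_of M = diffop_plus M.
Proof.
apply/seteqP; split=> [f [G [balG invG _]]|f Df].
  exact: balanced_sub_diffop_plus.
exists (diffop_plus M) => //; have [] := invariants_diffop_plus M.
by split=> //; apply: balanced_diffop_plus.
Qed.

Lemma dominant_lie_of M : dominant_lie L (lie_of M).
Proof.
rewrite lie_ofE; split=> [|G balG]; first exact: balanced_diffop_plus.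
have [-> _] := invariants_diffop_plus M.
exact: balanced_sub_diffop_plus.
Qed.

(** Dominance is applied to [diffop_plus M], which has the same invariants as [G]. *)
Lemma dominant_eq_lie_of G : dominant_lie L G -> exists M, lie_of M = G.
Proof.
case=> balG domG; have [M defM] := cent_L_subfield G.
have invG : invariants G = [set x | x \in M] by rewrite defM balG.2.
exists M; rewrite lie_ofE; apply/seteqP; split.
  apply: domG; first exact: balanced_diffop_plus.
  by have [-> _] := invariants_diffop_plus M.
exact: balanced_sub_diffop_plus.
Qed.

End Correspondence.

(** * Pure inseparability and the conclusion *)

Lemma subfield_set_inj (K : fieldType) (L : fieldExtType K) :
  injective (fun M : {subfield L} => [set x | x \in M]).
Proof.
move=> M N MN; apply/val_inj/vspaceP=> x; apply/idP/idP => [Mx|Nx].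
  by have : [set x | x \in M] x by []; rewrite MN.
by have : [set x | x \in N] x by []; rewrite -MN.
Qed.

Lemma purely_inseparable_diffop (K : fieldType) (L : fieldExtType K) (p : nat)
    (M : {subfield L}) : p \in [pchar K] ->
  purely_inseparable 1%VS {:L}%VS -> diffop M = endo_over M.
Proof.
move=> pK /purely_inseparableP insep; apply: (diffop_endo_over pK) => l.
have /purely_inseparable_elementP_pchar[n nL l1] := insep l (memvf l).
have pL : p \in [pchar L] by rewrite pchar_lalg.
(* The prime factors of [n] are only known to be characteristics of [L]; [p] is the only one. *)
rewrite (eq_pnat _ (pcharf_eq pL)) in nL.
have [e def_n] := p_natP nL; exists e; rewrite -def_n.
exact: subvP (sub1v M) _ l1.
Qed.

(** The inverse maps are expressed by round trips. A centralizer in D(L/K) is a set of operators, so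
    [M] appears there as [subf_lmuls M]. *)
Theorem theorem4p6 (K : fieldType) (L : fieldExtType K) (p : nat)
    (pcharKp : p \in [pchar K])
    (insepLK : purely_inseparable 1%VS {:L}%VS) :
  [/\ (* 1 *)
      subalgs_containing_L L = simple_subalgs_containing_L L /\
      simple_subalgs_containing_L L = [set diffop M | M in [set: {subfield L}]],
      (* 2 *)
      [/\ forall M : {subfield L}, cent_diffop (subf_lmuls M) = diffop M,
          set_bij [set: {subfield L}] (subalgs_containing_L L)
            (fun M => cent_diffop (subf_lmuls M)),
          forall M : {subfield L},
            cent_diffop (cent_diffop (subf_lmuls M)) = subf_lmuls M
        & forall A, subalgs_containing_L L A -> exists M : {subfield L},
            cent_diffop A = subf_lmuls M /\ cent_diffop (subf_lmuls M) = A],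
      (* 3 *)
      (forall M : {subfield L}, lie_of M = diffop_plus M) /\
      dominant_lie L = [set lie_of M | M in [set: {subfield L}]]
    & (* 4 *)
      [/\ set_bij [set: {subfield L}] (dominant_lie L) (@lie_of K L),
          forall M : {subfield L},
            invariants (lie_of M) = [set x | x \in M] /\
            cent_L (lie_of M) = [set x | x \in M]
        & forall G, dominant_lie L G -> exists M : {subfield L},
            [/\ invariants G = [set x | x \in M],
                cent_L G = [set x | x \in M] & lie_of M = G]]].
Proof.
have diffopE M := purely_inseparable_diffop M pcharKp insepLK.
have simpleE : simple_subalgs_containing_L L = subalgs_containing_L L.
  apply/seteqP; split=> [A [] // | A alA]; split=> //.
  by case: alA => _; apply: subalg_simple.
have diffopsE :
    subalgs_containing_L L = [set diffop M | M in [set: {subfield L}]].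
  apply/seteqP; split=> [A /(subalg_diffop diffopE)[M ->] | _ [M _ <-]].
    by exists M.
  exact: diffop_subalg.
have centK (M : {subfield L}) :
    cent_diffop (cent_diffop (subf_lmuls M)) = subf_lmuls M.
  by rewrite cent_diffop_subf_lmuls // cent_diffop_diffop.
have inv_lie (M : {subfield L}) : invariants (lie_of M) = [set x | x \in M] /\
    cent_L (lie_of M) = [set x | x \in M].
  by rewrite lie_ofE //; apply: invariants_diffop_plus.
split.
- by rewrite simpleE diffopsE.
- split=> //.
  + by move=> M; apply: cent_diffop_subf_lmuls.
  + split=> [M _|M N _ _ eqMN|A /(subalg_diffop diffopE)[M ->]].
    * by rewrite /= cent_diffop_subf_lmuls //; apply: diffop_subalg.
    (* [M] is recovered from [diffop M] as its centralizer in [L]. *)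
    * apply: subfield_set_inj; rewrite -!cent_L_endo_over -!diffopE.
      by rewrite -!cent_diffop_subf_lmuls // eqMN.
    * by exists M => //=; rewrite cent_diffop_subf_lmuls.
  + move=> A /(subalg_diffop diffopE)[M ->]; exists M.
    by rewrite cent_diffop_subf_lmuls // cent_diffop_diffop.
- split=> [M|]; first exact: lie_ofE.
  apply/seteqP; split=> [G /(dominant_eq_lie_of diffopE)[M <-] | _ [M _ <-]].
    by exists M.
  exact: dominant_lie_of.
- split=> // [|G /(dominant_eq_lie_of diffopE)[M <-]].
    split=> [M _|M N _ _ eqMN|G /(dominant_eq_lie_of diffopE)[M <-]].
    * exact: dominant_lie_of.
    * apply: subfield_set_inj; have [<- _] := inv_lie M.
      by have [<- _] := inv_lie N; rewrite eqMN.
    * by exists M.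
  by exists M; have [-> ->] := inv_lie M.
Qed.
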